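(* Let $(\mathcal{F},\oplus,+)$ be a commutative perfect semi-field of characteristic $1$, with fixed element $E$, satisfying the standing assumptions in the context. Then $S_E(\mathcal{F})$ is a compact topological space for the topology $\mathcal{T}$.
   Context: A commutative perfect semi-field of characteristic $1$ is a triple $(\mathcal{F},\oplus,+)$ where: $\oplus$ is a commutative associative law with $X\oplus X=X$ for all $X$; $(\mathcal{F},+)$ is an abelian group with identity $0$ and $X+(Y\oplus Z)=(X+Y)\oplus(X+Z)$ for all $X,Y,Z$; for every integer $n\ge 1$ the map $X\mapsto nX$ is surjective (it is then bijective, and $(\mathcal F,+)$ is naturally a $\mathbb{Q}$-vector space). Partial order: $X\le Y$ iff $X\oplus Y=Y$. Standing assumptions: $\mathcal{F}\neq\{0\}$; there is a fixed $E\in\mathcal{F}$ such that for every $X\in\mathcal{F}$ there is $t\in\mathbb{Q}^+$ (non-negative rationals) with $-tE\le X\le tE$; $r(X)\in\mathbb{R}^+$ denotes the infimum of all such $t$; and $r(X)=0$ if and only if $X=0$. A character of $\mathcal{F}$ is a map $\phi:\mathcal{F}\to\mathbb{R}$, not identically zero, with $\phi(X\oplus Y)=\max(\phi(X),\phi(Y))$ and $\phi(X+Y)=\phi(X)+\phi(Y)$ for all $X,Y$. $S_E(\mathcal{F})$ is the set of characters with $\phi(E)=1$, and $\mathcal{T}$ is the weakest topology on $S_E(\mathcal{F})$ making all maps $\phi\mapsto\phi(X)$, $X\in\mathcal{F}$, continuous. Compact includes Hausdorff. No completeness of $\mathcal{F}$ is assumed. *)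

(* Defs.v *)
From HB Require Import structures.
From mathcomp Require Import all_boot all_order all_algebra.
From mathcomp Require Import all_classical all_reals all_analysis.
Import Order.TTheory GRing.Theory Num.Theory.
Import numFieldNormedType.Exports.

Set Implicit Arguments.
Unset Strict Implicit.
Unset Printing Implicit Defensive.

Local Open Scope classical_set_scope.
Local Open Scope ring_scope.

(* The abelian group (F, +) is the zmodType structure of F; [op] is the
   idempotent law \oplus. *)
Record perfect_semifield_char1 (F : zmodType) (op : F -> F -> F) : Prop := {
  op_comm : commutative op;
  op_assoc : associative op;
  op_idem : forall X : F, op X X = X;
  add_op_distr : forall X Y Z : F, X + op Y Z = op (X + Y) (X + Z);
  mulrn_surj : forall n : nat, (1 <= n)%N ->
    forall Y : F, exists X : F, X *+ n = Y }.

Definition sf_le (F : zmodType) (op : F -> F -> F) (X Y : F) : Prop :=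
  op X Y = Y.

(* In a commutative perfect semi-field of characteristic 1, [ratscale t X] is
   the unique Z with (denq t) Z = (numq t) X, see [ratscaleP]: this is the
   natural action of the rationals on F.  The default 0 is then never used. *)
Definition ratscale (F : zmodType) (t : rat) (X : F) : F :=
  xget 0 [set Z : F | Z *~ denq t = X *~ numq t].

Lemma mulrn_inj (F : zmodType) (op : F -> F -> F) :
  perfect_semifield_char1 op ->
  forall n : nat, (1 <= n)%N -> injective (fun X : F => X *+ n).
Proof.
move=> [opC opA opI addop _] n n1.
have tors (X : F) : X *+ n = 0 -> X = 0.
  case: n n1 => [//|[|m]] _ XN0; first by rewrite mulr1n in XN0.
  pose S k := iteri k (fun i Y => op Y (X *+ i.+1)) (0 : F).
  have SD k : S k.+1 + X = op (S k + X) (X *+ k.+2).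
    by rewrite addrC /= addop -mulrS [X + _]addrC.
  have S0 k : op 0 (S k + X) = S k.+1.
    elim: k => [|k IHk]; first by rewrite /= add0r mulr1n.
    by rewrite SD opA IHk.
  have : S m.+1 + X = S m.+1 by rewrite SD XN0 opC S0.
  by move/eqP; rewrite -subr_eq0 addrAC subrr add0r => /eqP.
move=> X Y /= XY; apply/eqP; rewrite -subr_eq0; apply/eqP; apply: tors.
by rewrite mulrnBl XY subrr.
Qed.

Lemma ratscaleP (F : zmodType) (op : F -> F -> F) :
  perfect_semifield_char1 op -> forall (t : rat) (X Z : F),
  ratscale t X = Z <-> Z *~ denq t = X *~ numq t.
Proof.
move=> hF t X Z.
have dE (V : F) : V *~ denq t = V *+ `|denq t|%N.
  by rewrite -{1}(gez0_abs (denq_ge0 t)) -pmulrn.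
have d1 : (1 <= `|denq t|)%N by rewrite absz_gt0 denq_neq0.
have H : ratscale t X *~ denq t = X *~ numq t.
  have [W hW] := mulrn_surj hF d1 (X *~ numq t).
  apply: (@xgetPex F 0 [set Z : F | Z *~ denq t = X *~ numq t]).
  by exists W; rewrite /= dE.
split=> [<- //|hZ]; apply: (mulrn_inj hF d1).
by rewrite -!dE H hZ.
Qed.

Definition E_bound (F : zmodType) (op : F -> F -> F) (E X : F) (t : rat) :
  Prop :=
  [/\ 0 <= t, sf_le op (- ratscale t E) X & sf_le op X (ratscale t E)].

Definition sf_radius (R : realType) (F : zmodType) (op : F -> F -> F)
    (E X : F) : R :=
  inf [set ratr t | t in [set t : rat | E_bound op E X t]].

Record standing_assumptions (R : realType) (F : zmodType)
    (op : F -> F -> F) (E : F) : Prop := {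
  sf_nontrivial : exists X : F, X <> 0;
  sf_E_bounded : forall X : F, exists t : rat, E_bound op E X t;
  sf_radius_eq0 : forall X : F, sf_radius R op E X = 0 <-> X = 0 }.

Record is_character (R : realType) (F : zmodType) (op : F -> F -> F)
    (phi : F -> R) : Prop := {
  char_neq0 : exists X : F, phi X <> 0;
  char_max : forall X Y : F, phi (op X Y) = Num.max (phi X) (phi Y);
  char_add : forall X Y : F, phi (X + Y) = phi X + phi Y }.

Definition normalized_characters (R : realType) (F : zmodType)
    (op : F -> F -> F) (E : F) : set (F -> R) :=
  [set phi | is_character op phi /\ phi E = 1].

Arguments normalized_characters R [F] op E.

Definition char_eval (R : realType) (F : zmodType) (op : F -> F -> F)
    (E X : F) (phi : normalized_characters R op E) : R := val phi X.

(* The set of normalized characters with the supremum, over all X, of the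
   initial topologies of the evaluation maps at X, i.e. with the weakest
   topology making all evaluation maps continuous. *)
Definition char_space (R : realType) (F : zmodType) (op : F -> F -> F)
    (E : F) : topologicalType :=
  sup_topology (fun X : F =>
    Topological.on (initial_topology (@char_eval R F op E X))).

(* Main.v *)
(** The evaluations embed S_E(F) in a product of real intervals: if
    -tE <= X <= tE, then |phi(X)| <= t for every normalized character phi.
    Hence every ultrafilter on S_E(F) converges pointwise, and its pointwise
    limit is again a normalized character because the defining equations pass
    to the limit; the equation phi(E) = 1 keeps the limit nonzero.
    The space is Hausdorff since evaluations separate characters. *)
From HB Require Import structures.
Require Import Defs.
From mathcomp Require Import all_boot all_order all_algebra.
From mathcomp Require Import all_classical all_reals all_analysis.
Import Order.TTheory GRing.Theory Num.Theory.
Import numFieldNormedType.Exports.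

Local Open Scope classical_set_scope.

(** Compactness gives a cluster point [p]. If [V] is a neighbourhood of [p] and [f @^-1]
    V[is not in]F[, the ultrafilter contains its complement, so]~[V] would have to meet [V]. *)
Lemma ultra_compact_cvg {T : Type} {U : topologicalType} (f : T -> U)
    (F : set_system T) (K : set U) :
  UltraFilter F -> compact K -> F (f @^-1` K) ->
  exists2 p, K p & f @ F --> p.
Proof.
move=> FU cK FK; have [p [Kp clp]] := cK (f @ F) _ FK.
exists p => // V Vp; have [//|FnV] := in_ultra_setVsetC (f @^-1` V) FU.
by have [x [nVx /nVx]] := clp (~` V) V FnV Vp.
Qed.

Section initial_family.
Context {I : Type} {T : choiceType} {U : I -> topologicalType}.
Variable f : forall i, T -> U i.

Let initialT : topologicalType :=
  sup_topology (fun i => Topological.on (initial_topology (f i))).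

Lemma cvg_initial_family (F : set_system T) (x : T) : Filter F ->
  F --> (x : initialT) <-> forall i, f i @ F --> f i x.
Proof.
move=> FF; rewrite cvg_sup; split=> [Fx i|fFx i].
- by move=> A fxA; apply: Fx; exact: initial_continuous fxA.
(* It is enough to treat basic neighbourhoods, the preimages under [f i] of open sets containing
   [f i x]. *)
- move=> A; have /= -> := @nbhsE (initial_topology (f i)) x.
  move=> [_ [[B oB <-] Bx] BA]; apply: filterS BA _.
  by apply: fFx; apply: open_nbhs_nbhs.
Qed.

(** Each [f i] is continuous, so if [x] and [y] have no disjoint neighbourhoods, neither do [f i x]
    and [f i y]. *)
Lemma hausdorff_initial_family :
  (forall i, hausdorff_space (U i)) ->
  (forall x y : T, (forall i, f i x = f i y) -> x = y) ->
  hausdorff_space initialT.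
Proof.
move=> hU sepf x y clxy; apply: sepf => i; apply: hU => A B Ax By.
have cf z : f i @ nbhs (z : initialT) --> f i z.
  exact: (cvg_initial_family _ z (nbhs_filter (z : initialT))).1 (fun=> id) i.
by have [z [? ?]] := clxy _ _ (cf x _ Ax) (cf y _ By); exists (f i z).
Qed.

End initial_family.

Local Open Scope ring_scope.

Section characters.
Context {R : realType} {F : zmodType} {op : F -> F -> F}.
Variable phi : F -> R.
Hypothesis hphi : is_character op phi.

Let addphi := char_add hphi.

Lemma char_zmod_morphism : zmod_morphism phi.
Proof. by move=> X Y; rewrite -[in RHS](subrK Y X) [in RHS]addphi addrK. Qed.

HB.instance Definition _ := GRing.isZmodMorphism.Build F R phi
  char_zmod_morphism.

Lemma char_le (X Y : F) : sf_le op X Y -> phi X <= phi Y.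
Proof. by move=> XY; rewrite -XY (char_max hphi) le_max lexx. Qed.

(** Additivity gives compatibility with integer multiples; the integer equation defining
    [ratscale t X] is sent to [R] and divided there by [denq t]. *)
Lemma char_ratscale (hF : perfect_semifield_char1 op) (t : rat) (X : F) :
  phi (ratscale t X) = ratr t * phi X.
Proof.
have := congr1 phi ((ratscaleP hF t X _).1 erefl).
rewrite !raddfMz -[LHS]mulrzr -[RHS]mulrzl /ratr mulrAC => <-.
by rewrite mulfK // intr_eq0 denq_eq0.
Qed.

Lemma char_bound (hF : perfect_semifield_char1 op) (E X : F) (t : rat) :
  phi E = 1 -> E_bound op E X t -> phi X \in `[- ratr t, ratr t]%R.
Proof.
move=> phiE [_ tX Xt].
have <- : phi (ratscale t E) = ratr t by rewrite char_ratscale // phiE mulr1.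
by rewrite in_itv /= -raddfN !char_le.
Qed.

End characters.

Lemma normalized_character_cvg {R : realType} {F : zmodType}
    {op : F -> F -> F} (E : F) {T : Type} (G : set_system T)
    (u : T -> F -> R) (phi : F -> R) : ProperFilter G ->
  (forall x, normalized_characters R op E (u x)) ->
  (forall X, u ^~ X @ G --> phi X) -> normalized_characters R op E phi.
Proof.
move=> GG hu uphi.
(* Limits in [R] are unique, so an identity satisfied by all [u x] yields one for [phi] once the
   limit of its right-hand side is known. *)
have lim_eq X (v : T -> R) l : u ^~ X =1 v -> v @ G --> l -> phi X = l.
  move=> /funext uv vl; apply: (cvg_unique (@Rhausdorff R) (uphi X)).
  by rewrite uv.
have phiE : phi E = 1.
  by apply: (lim_eq E (cst 1)) (cvg_cst _) => x; have [] := hu x.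
split=> //; split.
- by exists E; rewrite phiE; apply/eqP; rewrite oner_eq0.
- move=> X Y; apply: (lim_eq _ (fun x => Num.max (u x X) (u x Y))).
    by move=> x; have [/char_max] := hu x.
  apply: continuous2_cvg (uphi X) (uphi Y).
  exact: (@max_continuous _ R (phi X, phi Y)).
- move=> X Y; apply: (lim_eq _ (fun x => u x X + u x Y)).
    by move=> x; have [/char_add] := hu x.
  by apply: cvgD; exact: uphi.
Qed.

Theorem theorem1 (R : realType) (F : zmodType) (op : F -> F -> F) (E : F)
  (hF : perfect_semifield_char1 op)
  (hE : standing_assumptions R op E) :
  compact [set: char_space R op E] /\ hausdorff_space (char_space R op E).
Proof.
split; last first.
  apply: hausdorff_initial_family => [X|x y xy]; first exact: Rhausdorff.
  by apply: val_inj; apply/funext.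
rewrite compact_ultra => G GU _.
(* The limit is found one coordinate [X] at a time, and choice assembles these reals into a
   function. *)
have /choice[phi evphi] X : exists r : R, @char_eval R F op E X @ G --> r.
  have [t Xt] := sf_E_bounded hE X.
  have [||r _] := ultra_compact_cvg (@char_eval R F op E X) G
    `[- ratr t, ratr t]%classic; [exact: segment_compact| |by exists r].
  (* The bound [t] depends on [X] only, so all characters take their value at [X] in the same
     segment. *)
  apply: filterE => x; have [hx xE] := set_valP x.
  exact: char_bound hx hF _ _ _ xE Xt.
have phiP : normalized_characters R op E phi.
  exact: normalized_character_cvg (fun x => set_valP x) evphi.
pose x : normalized_characters R op E := exist _ phi (mem_set phiP).
by exists x; split => //; apply/cvg_initial_family.
Qed.
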